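(* Let $R$ be a ring and let $U$ be a subgroup of $R^\times$. The map $\Phi_U$ is a one-to-one correspondence (bijection) $$\Phi_U\colon \mathrm{SL}_2(R)\backslash\{\text{pairs of bi-infinite paths in }\mathscr{F}_{R,U}\}\longrightarrow (U\times U)\backslash\{\text{tame }\mathrm{SL}_2\text{-tilings over }R\}.$$
   Context: All rings are commutative with identity $1$; $R^\times$ is the group of units of $R$. A pair $(a,b)\in R\times R$ is unimodular if $aR+bR=R$. For a subgroup $U\leq R^\times$, the Farey complex $\mathscr{F}_{R,U}$ is the directed graph whose vertices are the orbits $U(a,b)=\{(\lambda a,\lambda b):\lambda\in U\}$ of unimodular pairs (written $a/b$), with a directed edge from $a/b$ to $c/d$ if $ad-bc\in U$. Write $\mathscr{E}_R=\mathscr{F}_{R,\{1\}}$: its vertices are unimodular pairs, with an edge $(a,b)\to(c,d)$ if and only if $ad-bc=1$. Let $\pi_U\colon\mathscr{E}_R\to\mathscr{F}_{R,U}$, $(x,y)\mapsto U(x,y)$. A bi-infinite path in $\mathscr{F}_{R,U}$ is a sequence of vertices $(v_i)_{i\in\mathbb{Z}}$ with $v_{i-1}\to v_i$ a directed edge for all $i\in\mathbb{Z}$. A matrix $A=\begin{pmatrix}a&b\\c&d\end{pmatrix}\in\mathrm{SL}_2(R)$ acts on vertices by $x/y\mapsto (ax+by)/(cx+dy)$ and acts on pairs of bi-infinite paths by $(\gamma,\delta)\mapsto(A\gamma,A\delta)$. An $\mathrm{SL}_2$-tiling over $R$ is a function $\mathbf{M}\colon\mathbb{Z}\times\mathbb{Z}\to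 R$, $m_{i,j}=\mathbf{M}(i,j)$, with $m_{i,j}m_{i+1,j+1}-m_{i,j+1}m_{i+1,j}=1$ for all $i,j$. It is tame if every 3-by-3 submatrix of contiguous entries (rows $i-1,i,i+1$, columns $j-1,j,j+1$) has determinant $0$. The group $U\times U$ acts on tame $\mathrm{SL}_2$-tilings by $m_{i,j}\mapsto\lambda^{(-1)^i}\mu^{(-1)^j}m_{i,j}$ for $(\lambda,\mu)\in U\times U$. The map $\Phi_U$ is defined as follows. Given a pair $(\gamma,\delta)$ of bi-infinite paths in $\mathscr{F}_{R,U}$, choose any bi-infinite paths $\tilde\gamma,\tilde\delta$ in $\mathscr{E}_R$ with $\pi_U(\tilde\gamma)=\gamma$ and $\pi_U(\tilde\delta)=\delta$ (such lifts exist), with vertices $(a_i,b_i)$ and $(c_j,d_j)$ respectively. Then $\Phi_U$ sends the $\mathrm{SL}_2(R)$-orbit of $(\gamma,\delta)$ to the $(U\times U)$-orbit of the tame $\mathrm{SL}_2$-tiling with entries $m_{i,j}=a_id_j-b_ic_j$ (this is well defined). *)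

(* Defs.v *)
From HB Require Import structures.
From mathcomp Require Import all_boot all_order all_algebra.
From mathcomp Require Import boolp classical_sets.
From mathcomp Require Import ring zify.

Set Implicit Arguments.
Unset Strict Implicit.
Unset Printing Implicit Defensive.

Import GRing.Theory.
Local Open Scope classical_set_scope.
Local Open Scope ring_scope.

(* Orbits are taken as sets of points, and an orbit space is a set of sets,    *)
(* used below as a type through the coercion [set_type].                       *)
Definition orbit_of (G X : Type) (act : G -> X -> X) (x : X) : set X :=
  [set act g x | g in setT].

Definition orbit_space (G X : Type) (act : G -> X -> X) : set (set X) :=
  [set orbit_of act x | x in setT].

Definition set_elt (T : Type) (A : set T) (x : T) (Ax : A x) : A :=
  exist _ x (mem_set Ax).

Definition to_orbit (G X : Type) (act : G -> X -> X) (x : X) :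
    orbit_space act :=
  set_elt (imageT (orbit_of act) x).

Lemma orbit_repr_ex (G X : Type) (act : G -> X -> X) (O : orbit_space act) :
  exists x, to_orbit act x = O.
Proof.
by have [x _ xO] := set_valP O; exists x; apply/val_inj.
Qed.

(* The library's unit rings are all nonzero, so units are handled directly in  *)
(* [comPzRingType], which also covers the zero ring. The third clause says     *)
(* both that the elements are units and that U is closed under inverses.       *)
Record unitSubgroup (R : comPzRingType) := UnitSubgroup {
  usub :> set R;
  usub1 : usub 1;
  usubM : forall x y, usub x -> usub y -> usub (x * y);
  usubV : forall x, usub x -> exists2 y, usub y & x * y = 1
}.

Section Tilings.
Variable R : comPzRingType.

(* The inverse of x when x is a unit, and 1 otherwise. *)
Definition rinv (x : R) : R := xget 1 [set y | x * y = 1].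

(* x ^ ((-1) ^ i) for a unit x. *)
Definition altexp (x : R) (i : int) : R := if odd `|i|%N then rinv x else x.

Definition is_SL2_tiling (M : int -> int -> R) : Prop :=
  forall i j, M i j * M (i + 1) (j + 1) - M i (j + 1) * M (i + 1) j = 1.

Definition is_tame (M : int -> int -> R) : Prop :=
  forall i j,
    \det (\matrix_(k < 3, l < 3) M (i - 1 + k%:Z) (j - 1 + l%:Z)) = 0.

Definition tame_tiling : set (int -> int -> R) :=
  [set M | is_SL2_tiling M /\ is_tame M].

Definition SL2 : set 'M[R]_2 := [set A | \det A = 1].

Definition unimodular (p : R * R) : Prop :=
  [set p.1 * x + p.2 * y | x in setT & y in setT] = setT.

Definition upair : set (R * R) := [set p | unimodular p].

Definition wedge (p q : R * R) : R := p.1 * q.2 - p.2 * q.1.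

Definition mulp (A : 'M[R]_2) (p : R * R) : R * R :=
  (A 0 0 * p.1 + A 0 1 * p.2, A 1 0 * p.1 + A 1 1 * p.2).

Definition scalep (l : R) (p : R * R) : R * R := (l * p.1, l * p.2).

Definition bipath (V : Type) (e : V -> V -> Prop) : set (int -> V) :=
  [set g | forall i, e (g (i - 1)) (g i)].

(* The edges of E_R, the Farey complex for the trivial unit group. *)
Definition E_edge (p q : upair) : Prop := wedge (val p) (val q) = 1.

Definition entries (g d : bipath E_edge) (i j : int) : R :=
  wedge (val (val g i)) (val (val d j)).

Lemma det2 (A : 'M[R]_2) : \det A = A 0 0 * A 1 1 - A 0 1 * A 1 0.
Proof.
rewrite (expand_det_row _ 0) !big_ord_recl big_ord0 /cofactor !det_mx11 !mxE /=.
have -> : lift 0 0 = 1 :> 'I_2 by apply/val_inj.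
have -> : lift 1 0 = 0 :> 'I_2 by apply/val_inj.
rewrite /bump /= expr0 expr1; ring.
Qed.

Lemma det3 (f : nat -> nat -> R) : \det (\matrix_(k < 3, l < 3) f k l) =
  f 0%N 0%N * (f 1%N 1%N * f 2%N 2%N - f 1%N 2%N * f 2%N 1%N)
  - f 0%N 1%N * (f 1%N 0%N * f 2%N 2%N - f 1%N 2%N * f 2%N 0%N)
  + f 0%N 2%N * (f 1%N 0%N * f 2%N 1%N - f 1%N 1%N * f 2%N 0%N).
Proof.
rewrite (expand_det_row _ 0) !big_ord_recl big_ord0 /cofactor !det2 !mxE /=.
rewrite /bump /= /bump /= ?addn0 ?add0n ?addn1 ?add1n.
rewrite expr0 expr1 sqrrN expr1n; ring.
Qed.

Lemma unimodularP p :
  unimodular p <-> exists x y, p.1 * x + p.2 * y = 1.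
Proof.
split=> [pE|[x [y xy]]].
  have : [set p.1 * x + p.2 * y | x in setT & y in setT] 1 by rewrite pE.
  by move=> [x _ [y _ xy]]; exists x, y.
apply/seteqP; split=> // r _; exists (x * r) => //; exists (y * r) => //.
by rewrite !mulrA -mulrDl xy mul1r.
Qed.

Lemma rinvE (x y : R) : x * y = 1 -> rinv x = y.
Proof.
move=> xy; have xV : x * rinv x = 1 by apply: (@xgetPex _ 1 [set z | x * z = 1]); exists y.
by rewrite -[LHS]mulr1 -xy mulrA [_ * x]mulrC xV mul1r.
Qed.

Lemma altexpS (x y : R) : x * y = 1 ->
  forall i, altexp x (i - 1) * altexp x i = 1.
Proof.
move=> xy i; rewrite /altexp (rinvE xy).
have -> : odd `|i - 1|%N = ~~ odd `|i|%N by lia.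
by case: odd => //=; rewrite mulrC.
Qed.

Lemma altexp_tame (l l' m m' : R) (M : int -> int -> R) :
  l * l' = 1 -> m * m' = 1 -> tame_tiling M ->
  tame_tiling (fun i j => altexp l i * altexp m j * M i j).
Proof.
move=> ll mm [MS Mt]; split=> i j.
  have /(_ (i + 1)) := altexpS ll; have /(_ (j + 1)) := altexpS mm.
  rewrite !addrK => mj li; rewrite -[RHS](MS i j).
  transitivity ((altexp l i * altexp l (i + 1)) * (altexp m j * altexp m (j + 1)) *
     (M i j * M (i + 1) (j + 1) - M i (j + 1) * M (i + 1) j)); first by ring.
  by rewrite mj li !mul1r.
have := Mt i j.
rewrite (det3 (fun k n => M (i - 1 + k%:Z) (j - 1 + n%:Z))).
rewrite (det3 (fun k n => altexp l (i - 1 + k%:Z) * altexp m (j - 1 + n%:Z) *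
  M (i - 1 + k%:Z) (j - 1 + n%:Z))).
set f := fun k n : nat => M (i - 1 + k%:Z) (j - 1 + n%:Z).
set a := fun k : nat => altexp l (i - 1 + k%:Z).
set b := fun k : nat => altexp m (j - 1 + k%:Z) => f0.
rewrite -[RHS](mulr0 (a 0%N * a 1%N * a 2%N * b 0%N * b 1%N * b 2%N)) -f0.
by rewrite /f /a /b; ring.
Qed.

Lemma wedge_scale l m p q :
  wedge (scalep l p) (scalep m q) = l * m * wedge p q.
Proof. by rewrite /wedge /=; ring. Qed.

Lemma wedge_mulp A p q : SL2 A -> wedge (mulp A p) (mulp A q) = wedge p q.
Proof.
rewrite /SL2 /= det2 => A1; rewrite -[RHS]mul1r -A1 /wedge /=; ring.
Qed.

Lemma mulp_scale A l p : mulp A (scalep l p) = scalep l (mulp A p).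
Proof. by rewrite /mulp /scalep /=; congr pair; ring. Qed.

Lemma mulp_unimodular A p : SL2 A -> unimodular p -> unimodular (mulp A p).
Proof.
rewrite /SL2 /= det2 => A1 /unimodularP [s [t st]]; apply/unimodularP.
exists (A 1 1 * s - A 1 0 * t), (- A 0 1 * s + A 0 0 * t) => /=.
by rewrite -[RHS]mulr1 -{1}st -A1; ring.
Qed.

Lemma entries_tame (g d : bipath E_edge) : tame_tiling (entries g d).
Proof.
have gE i : wedge (val (val g i)) (val (val g (i + 1))) = 1.
  by have /(_ (i + 1)) := set_valP g; rewrite addrK.
have dE i : wedge (val (val d i)) (val (val d (i + 1))) = 1.
  by have /(_ (i + 1)) := set_valP d; rewrite addrK.
split=> i j; rewrite /entries.
  rewrite -[RHS]mul1r -{1}(gE i) -(dE j) /wedge; ring.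
rewrite (det3 (fun k n => wedge (val (val g (i - 1 + k%:Z)))
                                (val (val d (j - 1 + n%:Z))))) /wedge; ring.
Qed.

Definition tiling_of (g d : bipath E_edge) : tame_tiling :=
  set_elt (entries_tame g d).

Section Farey.
Variable G : unitSubgroup R.
Local Notation U := (usub G).

Definition uorbit (p : R * R) : set (R * R) := [set scalep l p | l in U].

Definition farey_vertex : set (set (R * R)) :=
  [set uorbit p | p in upair].

(* The projection pi_U. *)
Definition farey_pi (p : upair) : farey_vertex :=
  @set_elt _ farey_vertex (uorbit (val p)) (imageP uorbit (set_valP p)).

Definition farey_edge (v w : farey_vertex) : Prop :=
  exists p q : upair,
    [/\ farey_pi p = v, farey_pi q = w & U (wedge (val p) (val q))].

Definition farey_path : set (int -> farey_vertex) := bipath farey_edge.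

Lemma SL2_vertex_subproof (A : SL2) (v : farey_vertex) :
  farey_vertex [set mulp (val A) p | p in val v].
Proof.
have [p pu <-] := set_valP v; exists (mulp (val A) p).
  exact: mulp_unimodular (set_valP A) pu.
apply/seteqP; split=> [_ [l Ul <-]|_ [_ [l Ul <-] <-]].
  by exists (scalep l p); [exists l|rewrite mulp_scale].
by exists l => //; rewrite mulp_scale.
Qed.

Definition SL2_vertex (A : SL2) (v : farey_vertex) : farey_vertex :=
  set_elt (SL2_vertex_subproof A v).

Definition SL2_upair (A : SL2) (p : upair) : upair :=
  set_elt (mulp_unimodular (set_valP A) (set_valP p)).

Lemma SL2_vertex_pi A p : SL2_vertex A (farey_pi p) = farey_pi (SL2_upair A p).
Proof.
apply/val_inj/seteqP; split=> /= [_ [_ [l Ul <-] <-]|_ [l Ul <-]].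
  by exists l => //; rewrite mulp_scale.
by exists (scalep l (val p)); [exists l|rewrite mulp_scale].
Qed.

Lemma SL2_path_subproof (A : SL2) (g : farey_path) :
  farey_path (fun i => SL2_vertex A (val g i)).
Proof.
move=> i; have [p [q [<- <- Upq]]] := set_valP g i.
exists (SL2_upair A p), (SL2_upair A q); rewrite -!SL2_vertex_pi; split=> //=.
by rewrite wedge_mulp //; exact: set_valP A.
Qed.

Definition SL2_path (A : SL2) (g : farey_path) : farey_path :=
  set_elt (SL2_path_subproof A g).

Definition SL2_pair (A : SL2) (gd : farey_path * farey_path) :
    farey_path * farey_path :=
  (SL2_path A gd.1, SL2_path A gd.2).

Lemma UU_tiling_subproof (lm : U * U) (M : tame_tiling) :
  tame_tiling (fun i j =>
    altexp (val lm.1) i * altexp (val lm.2) j * val M i j).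
Proof.
have [l' _ ll] := usubV (set_valP lm.1).
have [m' _ mm] := usubV (set_valP lm.2).
exact: altexp_tame ll mm (set_valP M).
Qed.

Definition UU_tiling (lm : U * U) (M : tame_tiling) : tame_tiling :=
  set_elt (UU_tiling_subproof lm M).

Definition lifts_to (g' : bipath E_edge) (g : farey_path) : Prop :=
  forall i, farey_pi (val g' i) = val g i.

Lemma rinvU x : U x -> U (rinv x) /\ x * rinv x = 1.
Proof. by move=> /usubV [y Uy xy]; rewrite (rinvE xy). Qed.

Lemma farey_piP (p q : upair) : farey_pi p = farey_pi q <->
  exists2 l, U l & val p = scalep l (val q).
Proof.
split=> [/(congr1 val)/= pq|[l Ul pq]].
  have : uorbit (val p) (val p).
    by exists 1; [exact: usub1|rewrite /scalep !mul1r -surjective_pairing].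
  by rewrite pq => -[l Ul <-]; exists l.
have [m Um lm] := usubV Ul.
apply/val_inj => /=; rewrite pq; apply/seteqP; split=> _ [k Uk <-].
  by exists (k * l); [exact: usubM|rewrite /scalep /= !mulrA].
exists (k * m); first exact: usubM.
by rewrite /scalep /= !mulrA -[k * m * l]mulrA [m * l]mulrC lm mulr1.
Qed.

Lemma scale_upair (l : R) (p : upair) : U l -> unimodular (scalep l (val p)).
Proof.
move=> /usubV [m _ lm]; have /unimodularP [x [y xy]] := set_valP p.
apply/unimodularP; exists (m * x), (m * y) => /=.
by rewrite -[RHS]mulr1 -{1}xy -lm; ring.
Qed.

Lemma lift_ex (g : farey_path) : exists g' : bipath E_edge, lifts_to g' g.
Proof.
have /choice [r rE] : forall i, exists p : upair, farey_pi p = val g i.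
  move=> i; have [p pu pE] := set_valP (val g i).
  by exists (set_elt pu); apply/val_inj.
pose w i := wedge (val (r (i - 1))) (val (r i)).
have Uw i : U (w i).
  have [p [q [pE qE Upq]]] := set_valP g i.
  have /farey_piP [l Ul lE] : farey_pi (r (i - 1)) = farey_pi p by rewrite rE pE.
  have /farey_piP [m Um mE] : farey_pi (r i) = farey_pi q by rewrite rE qE.
  by rewrite /w lE mE wedge_scale; do 2?apply: usubM.
pose fix lp n := if n is k.+1 then rinv (lp k * w k.+1%:Z) else 1.
pose fix ln n := if n is k.+1 then rinv (ln k * w (- k%:Z)) else 1.
pose l i := match i with Posz n => lp n | Negz n => ln n.+1 end.
have Ulp n : U (lp n).
  elim: n => [|n IH] /=; first exact: usub1.
  by apply: (rinvU _).1; exact: usubM.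
have Uln n : U (ln n).
  elim: n => [|n IH]; first exact: usub1.
  by apply: (rinvU _).1; exact: usubM.
have Ul i : U (l i) by case: i => n; [exact: Ulp|exact: Uln].
have lN n : l (- n%:Z) = ln n by case: n => //= n; rewrite -NegzE.
have lw i : l (i - 1) * l i * w i = 1.
  have [n [->|->]] : exists n : nat, i = n.+1%:Z \/ i = - n%:Z.
  - by case: i => [[|n]|n]; [exists 0%N; right|exists n; left|exists n.+1; right].
  - have -> : n.+1%:Z - 1 = n%:Z by lia.
    rewrite /= mulrAC; exact: (rinvU (usubM (Ulp n) (Uw _))).2.
  have -> : - n%:Z - 1 = - n.+1%:Z by lia.
  rewrite !lN -mulrA mulrC; exact: (rinvU (usubM (Uln n) (Uw _))).2.
pose g' i : upair := set_elt (scale_upair (r i) (Ul i)).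
have g'P : bipath E_edge g' by move=> i; rewrite /E_edge /= wedge_scale lw.
exists (set_elt g'P) => i /=.
by rewrite -rE; apply/farey_piP; exists (l i).
Qed.

Definition path_lift (g : farey_path) : bipath E_edge := projT1 (cid (lift_ex g)).

Lemma liftP g : lifts_to (path_lift g) g.
Proof. exact: projT2 (cid (lift_ex g)). Qed.

Definition orbit_repr (O : orbit_space SL2_pair) : farey_path * farey_path :=
  projT1 (cid (orbit_repr_ex O)).

Lemma orbit_reprK O : to_orbit SL2_pair (orbit_repr O) = O.
Proof. exact: projT2 (cid (orbit_repr_ex O)). Qed.

(* The map Phi_U, computed from a chosen representative and chosen lifts;      *)
(* [PhiE] shows that the result does not depend on these choices.              *)
Definition Phi (O : orbit_space SL2_pair) : orbit_space UU_tiling :=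
  let: (g, d) := orbit_repr O in
  to_orbit UU_tiling (tiling_of (path_lift g) (path_lift d)).

(* Two lifts of a path and of its image under A differ by A and a factor       *)
(* l ^ ((-1) ^ i).                                                             *)
Lemma lift_rel (A : SL2) (g : farey_path) (g1 g2 : bipath E_edge) :
  lifts_to g1 g -> lifts_to g2 (SL2_path A g) ->
  exists l : U, forall i,
    val (val g2 i) = scalep (altexp (val l) i) (mulp (val A) (val (val g1 i))).
Proof.
move=> g1P g2P.
have /choice [l lP] : forall i, exists l, U l /\
    val (val g2 i) = scalep l (mulp (val A) (val (val g1 i))).
  move=> i; have : farey_pi (val g2 i) = farey_pi (SL2_upair A (val g1 i)).
    by rewrite -SL2_vertex_pi g1P g2P.
  by move=> /farey_piP [l Ul lE]; exists l.
have ll i : l (i - 1) * l i = 1.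
  have : E_edge (val g2 (i - 1)) (val g2 i) := set_valP g2 i.
  rewrite /E_edge (lP (i - 1)).2 (lP i).2 wedge_scale wedge_mulp; last exact: set_valP A.
  have g1i : E_edge (val g1 (i - 1)) (val g1 i) := set_valP g1 i.
  by rewrite g1i mulr1.
have lV i : rinv (l (i - 1)) = l i := rinvE (ll i).
have lV' i : rinv (l i) = l (i - 1) by apply: rinvE; rewrite mulrC ll.
exists (set_elt (lP 0).1) => i /=.
suff -> : altexp (l 0) i = l i by exact: (lP i).2.
have per i' : l (i' + 1 + 1) = l i'.
  by rewrite -(lV (i' + 1 + 1)) addrK lV' addrK.
have l1 : rinv (l 0) = l 1 by rewrite -(lV 1) subrr.
have ev n : l n%:Z = altexp (l 0) n%:Z /\ l n.+1%:Z = altexp (l 0) n.+1%:Z.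
  elim: n => [|n [IH1 IH2]]; first by rewrite /altexp /= l1.
  split=> //; have -> : n.+2%:Z = n%:Z + 1 + 1 by lia.
  rewrite per IH1 /altexp.
  by have -> : odd (absz (n%:Z + 1 + 1)) = odd (absz n) by lia.
have evN n : l (- n%:Z) = altexp (l 0) (- n%:Z) /\
             l (- n.+1%:Z) = altexp (l 0) (- n.+1%:Z).
  elim: n => [|n [IH1 IH2]].
    by split=> //; rewrite /altexp /= lV'.
  split=> //; rewrite -per; have -> : - n.+2%:Z + 1 + 1 = - n%:Z by lia.
  rewrite IH1 /altexp.
  by have -> : odd (absz (- n%:Z)) = odd (absz (- n.+2%:Z)) by lia.
by case: i => n; [rewrite (ev n).1|rewrite NegzE (evN n).2].
Qed.

Lemma UU_orbit_eq (M N : tame_tiling) (lm : U * U) :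
  (forall i j, val N i j =
     altexp (val lm.1) i * altexp (val lm.2) j * val M i j) ->
  to_orbit UU_tiling M = to_orbit UU_tiling N.
Proof.
case: lm => l m; rewrite [(l, m).1]/= [(l, m).2]/= => NE; apply/val_inj => /=.
have [Ul lK] := rinvU (set_valP l); have [Um mK] := rinvU (set_valP m).
have aM (x y x' y' : R) i : x * x' = 1 -> y * y' = 1 ->
    altexp (x * y) i = altexp x i * altexp y i.
  move=> xx yy; rewrite /altexp (rinvE xx) (rinvE yy).
  case: odd => //; apply: rinvE.
  by rewrite mulrACA xx yy mulr1.
have aV (x : R) i : x * rinv x = 1 -> altexp (rinv x) i * altexp x i = 1.
  move=> xx; rewrite /altexp (rinvE (_ : rinv x * x = 1)); last by rewrite mulrC.
  by case: odd => //; rewrite mulrC.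
have sub : forall (P Q : tame_tiling) (a b : R), U a -> U b ->
    (forall i j, val Q i j = altexp a i * altexp b j * val P i j) ->
    orbit_of UU_tiling Q `<=` orbit_of UU_tiling P.
  move=> P Q a b Ua Ub QE _ [[c d] _ <-].
  have Uc := set_valP c; have Ud := set_valP d.
  have [a' _ aa] := usubV Ua; have [b' _ bb] := usubV Ub.
  have [c' _ cc] := usubV Uc; have [d' _ dd] := usubV Ud.
  exists (set_elt (usubM Uc Ua), set_elt (usubM Ud Ub)) => //.
  apply/val_inj/funext => i; apply/funext => j.
  change (altexp (val c * a) i * altexp (val d * b) j * val P i j =
          altexp (val c) i * altexp (val d) j * val Q i j).
  rewrite (aM _ _ _ _ _ cc aa) (aM _ _ _ _ _ dd bb) QE. ring.
apply/seteqP; split; last exact: (sub _ _ _ _ (set_valP l) (set_valP m) NE).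
apply: (sub _ _ _ _ Ul Um) => i j; rewrite NE.
transitivity ((altexp (rinv (val l)) i * altexp (val l) i) *
  (altexp (rinv (val m)) j * altexp (val m) j) * val M i j); last by ring.
by rewrite !aV // !mul1r.
Qed.

Lemma PhiE (g d : farey_path) (g' d' : bipath E_edge) :
  lifts_to g' g -> lifts_to d' d ->
  Phi (to_orbit SL2_pair (g, d)) = to_orbit UU_tiling (tiling_of g' d').
Proof.
move=> gP dP; rewrite /Phi; have := orbit_reprK (to_orbit SL2_pair (g, d)).
case: orbit_repr => g0 d0 /(congr1 val)/= E.
have : orbit_of SL2_pair (g0, d0) (g, d).
  rewrite E; have S1 : SL2 1%:M by rewrite /SL2 /= det1.
  have vE (h : farey_path) : SL2_path (set_elt S1) h = h.
    apply/val_inj/funext => i; apply/val_inj => /=.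
    have m1 p : mulp 1%:M p = p.
      by case: p => x y; rewrite /mulp !mxE /= !mul1r !mul0r addr0 add0r.
    by under eq_imagel do rewrite m1; rewrite image_id.
  by exists (set_elt S1) => //; rewrite /SL2_pair /= !vE.
move=> [A _ [gE dE]]; rewrite -gE in gP; rewrite -dE in dP.
have [l lE] := lift_rel (@liftP g0) gP; have [m mE] := lift_rel (@liftP d0) dP.
apply: (@UU_orbit_eq _ _ (l, m)) => i j /=.
rewrite /entries lE mE wedge_scale wedge_mulp //; exact: set_valP A.
Qed.

End Farey.
End Tilings.

(* Main.v *)
Require Import Defs.
From mathcomp Require Import all_boot all_algebra.
From mathcomp Require Import boolp classical_sets ring zify.

(** The idea is that a pair of paths is rigid.  Two consecutive vertices p -> q
    of a path in E_R form a basis of R^2 of determinant 1, so a vector r is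
    recovered from the two numbers wedge r p and wedge r q
    ([wedge_basis_inj]), and SL_2(R) is transitive on such bases
    ([SL2_basis_transitive]).

    Injectivity.  If two pairs of paths in E_R have the same table of wedges,
    the matrix A that moves the first two vertices of one left path to those
    of the other must move every right vertex correctly, because right vertices
    are determined by their wedges with two left ones, and then every left
    vertex as well ([entries_rigid]).  A tiling that is known only up to the
    action of U x U costs nothing: the factors l ^ ((-1) ^ i) can be absorbed
    in the lift of the left path, since consecutive factors cancel, and
    m ^ ((-1) ^ j) in that of the right path ([Phi_orbit_inj]).

    Surjectivity.  Put the first two vertices of the left path at (1, 0) and
    (0, 1).  Rows 0 and 1 of a tiling M then dictate the right path, and
    columns 0 and 1 dictate the left path.  The resulting tiling N agrees with
    M on these two rows and two columns ([tiling_cross_realized]).  Tameness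
    says that each row is a combination of the two preceding ones,
    row (i+1) = r_i row i - row (i-1), where r_i can be read off any two
    adjacent columns ([tame_recurrence]).  Therefore M and N agree everywhere
    ([tame_cross_inj]). *)

Set Implicit Arguments.
Unset Strict Implicit.
Unset Printing Implicit Defensive.

Import GRing.Theory.
Local Open Scope classical_set_scope.
Local Open Scope ring_scope.

(** * Induction along the integers *)

Lemma int_pair_ind (P : int -> Prop) : P 0 -> P 1 ->
  (forall i, P (i - 1) -> P i -> P (i + 1)) ->
  (forall i, P i -> P (i + 1) -> P (i - 1)) -> forall i, P i.
Proof.
move=> P0 P1 up down i.
have pos n : P n%:Z /\ P n.+1%:Z.
  elim: n => [|n [IH1 IH2]]; first by split.
  split=> //; have -> : n.+2%:Z = n.+1%:Z + 1 by lia.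
  by apply: up => //; have -> : n.+1%:Z - 1 = n%:Z by lia.
have neg n : P (- n%:Z) /\ P (- n%:Z + 1).
  elim: n => [|n [IH1 IH2]]; first by split.
  have -> : - n.+1%:Z = - n%:Z - 1 by lia.
  by split; [exact: down|rewrite subrK].
by case: i => n; [exact: (pos n).1|rewrite NegzE; exact: (neg n.+1).1].
Qed.

Lemma int_constant (T : Type) (f : int -> T) :
  (forall j, f (j - 1) = f j) -> forall j, f j = f 0.
Proof.
move=> fE; apply: int_pair_ind => //.
- by rewrite -(fE 1) subrr.
- by move=> i _ <-; rewrite -(fE (i + 1)) addrK.
- by move=> i <- _; exact: fE.
Qed.

Section Correspondence.
Variable R : comPzRingType.

(** * Bases of determinant one *)

Lemma wedge1_unimodular (p q : R * R) : wedge p q = 1 -> unimodular p.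
Proof.
rewrite /wedge => pq; apply/unimodularP.
by exists q.2, (- q.1); rewrite -pq; ring.
Qed.

(** By Cramer's rule, r = wedge r q * p - wedge r p * q. *)
Lemma wedge_basis_inj (p q r s : R * R) : wedge p q = 1 ->
  wedge r p = wedge s p -> wedge r q = wedge s q -> r = s.
Proof.
move=> pq rp rq.
have cramer (t : R * R) : t = (wedge t q * p.1 - wedge t p * q.1,
                               wedge t q * p.2 - wedge t p * q.2).
  case: t => t1 t2; rewrite /=; congr pair.
    by rewrite -[LHS]mul1r -pq /wedge /=; ring.
  by rewrite -[LHS]mul1r -pq /wedge /=; ring.
by rewrite [r]cramer [s]cramer rp rq.
Qed.

Lemma SL2_basis_transitive (p q p' q' : R * R) :
  wedge p q = 1 -> wedge p' q' = 1 ->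
  exists2 A, SL2 A & mulp A p = p' /\ mulp A q = q'.
Proof.
case: p q p' q' => [p1 p2] [q1 q2] [p1' p2'] [q1' q2'].
rewrite /wedge /= => pq pq'.
(* A is the matrix with columns p', q' times the inverse of the one with
   columns p, q. *)
pose a (x y : R) (j : 'I_2) :=
  if j == 0 then x * q2 - y * p2 else y * p1 - x * q1.
pose A := \matrix_(i < 2, j < 2)
  if i == 0 then a p1' q1' j else a p2' q2' j.
exists A.
  by rewrite /SL2 /= det2 !mxE /a /= -[RHS]mulr1 -{1}pq -pq'; ring.
rewrite /mulp !mxE /a /=; split; congr pair.
all: by rewrite -[RHS]mul1r -pq; ring.
Qed.

(** * Rigidity of a pair of paths *)

Lemma entries_rigid (g d g' d' : int -> R * R) :
  wedge (g 0) (g 1) = 1 -> wedge (g' 0) (g' 1) = 1 ->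
  wedge (d' 0) (d' 1) = 1 ->
  (forall i j, wedge (g i) (d j) = wedge (g' i) (d' j)) ->
  exists2 A, SL2 A &
    (forall i, mulp A (g i) = g' i) /\ (forall j, mulp A (d j) = d' j).
Proof.
move=> g1 g1' d1' E.
have [A SA [A0 A1]] := SL2_basis_transitive g1 g1'.
have wC (p q : R * R) : wedge p q = - wedge q p by rewrite /wedge; ring.
have Ad j : mulp A (d j) = d' j.
  apply: (wedge_basis_inj g1').
    by rewrite -[in LHS]A0 wedge_mulp // wC E -wC.
  by rewrite -[in LHS]A1 wedge_mulp // wC E -wC.
exists A => //; split=> // i.
by apply: (wedge_basis_inj d1'); rewrite -[in LHS]Ad wedge_mulp.
Qed.

(** * Tame tilings are determined by two rows and two columns *)

(** Write a, b, c for rows i-1, i, i+1 and r_j for the minor of rows a, c in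
    columns j, j+1.  The adjacent minors being 1, the Pluecker relations give
    a + c = r_j b in columns j and j+1.  In columns j-1, j, j+1 the 3 x 3
    determinant is then (r_(j-1) - r_j) b_(j-1), while column j alone gives
    (r_(j-1) - r_j) b_j = 0; as b_(j-1) and b_j generate the unit ideal,
    r_j is independent of j. *)
Lemma tame_recurrence (M : int -> int -> R) : tame_tiling M -> forall i j,
  M (i - 1) j + M (i + 1) j =
  (M (i - 1) 0 * M (i + 1) 1 - M (i - 1) 1 * M (i + 1) 0) * M i j.
Proof.
move=> [MS Mt] i.
pose a := M (i - 1); pose b := M i; pose c := M (i + 1).
pose r j := a j * c (j + 1) - a (j + 1) * c j.
have ab j : a j * b (j + 1) - a (j + 1) * b j = 1.
  by have := MS (i - 1) j; rewrite subrK.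
have bc j : b j * c (j + 1) - b (j + 1) * c j = 1 := MS i j.
have rl j : a j + c j = r j * b j.
  by rewrite -[a j]mulr1 -[c j in LHS]mulr1 -{1}(bc j) -{1}(ab j) /r; ring.
have rr j : a (j + 1) + c (j + 1) = r j * b (j + 1).
  rewrite -[a (j + 1)]mulr1 -[c (j + 1) in LHS]mulr1 -{1}(bc j) -{1}(ab j) /r.
  by ring.
have rC j : r (j - 1) = r j.
  have rrj : a j + c j = r (j - 1) * b j by have := rr (j - 1); rewrite subrK.
  have bj0 : (r (j - 1) - r j) * b j = 0 by rewrite mulrBl -rl -rrj subrr.
  have bj1 : (r (j - 1) - r j) * b (j - 1) = 0.
    have := Mt i j.
    rewrite (det3 (fun k n => M (i - 1 + k%:Z) (j - 1 + n%:Z))).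
    have -> : i - 1 + 0%:Z = i - 1 by lia.
    have -> : i - 1 + 1%:Z = i by lia.
    have -> : i - 1 + 2%:Z = i + 1 by lia.
    have -> : j - 1 + 0%:Z = j - 1 by lia.
    have -> : j - 1 + 1%:Z = j by lia.
    have -> : j - 1 + 2%:Z = j + 1 by lia.
    rewrite -/a -/b -/c => det0; rewrite mulrBl -rl -[RHS]det0.
    rewrite -[a (j - 1)]mulr1 -[c (j - 1) in LHS]mulr1 -{1}(bc j) -{1}(ab j).
    by rewrite /r; ring.
  apply/eqP; rewrite -subr_eq0 -[X in X == 0]mulr1 -(ab (j - 1)) subrK.
  apply/eqP; transitivity (a (j - 1) * ((r (j - 1) - r j) * b j)
     - a j * ((r (j - 1) - r j) * b (j - 1))); first by ring.
  by rewrite bj0 bj1 !mulr0 subrr.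
by move=> j; rewrite -/a -/b -/c rl (int_constant rC) /r add0r.
Qed.

Lemma tame_cross_inj (M N : int -> int -> R) :
  tame_tiling M -> tame_tiling N ->
  M 0 =1 N 0 -> M 1 =1 N 1 -> M^~ 0 =1 N^~ 0 -> M^~ 1 =1 N^~ 1 ->
  forall i j, M i j = N i j.
Proof.
move=> Mt Nt M0 M1 N0 N1; apply: int_pair_ind => // i IH1 IH2 j.
  have := tame_recurrence Mt i j; rewrite !N0 !N1 IH2 IH1.
  by rewrite -tame_recurrence // => /addrI.
have := tame_recurrence Mt i j; rewrite !N0 !N1 IH2 IH1.
by rewrite -tame_recurrence // => /addIr.
Qed.

Lemma bipath_of_wedges (f : int -> R * R) :
  (forall i, wedge (f i) (f (i + 1)) = 1) ->
  exists g : bipath (@E_edge R), forall i, val (val g i) = f i.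
Proof.
move=> fE; have fu i : upair (f i) := wedge1_unimodular (fE i).
have fP : bipath (@E_edge R) (fun i => set_elt (fu i)).
  by move=> i; rewrite /E_edge -(fE (i - 1)) subrK.
by exists (set_elt fP).
Qed.

(** With left vertices (1, 0) and (0, 1) at indices 0 and 1, the right vertex
    d_j must be (- M 1 j, M 0 j); in the basis d_0, d_1 the left vertex g_i is
    then M i 1 * d_0 - M i 0 * d_1. *)
Lemma tiling_cross_realized (M : int -> int -> R) : is_SL2_tiling M ->
  exists g d : bipath (@E_edge R), let N := entries g d in
  [/\ M 0 =1 N 0, M 1 =1 N 1, M^~ 0 =1 N^~ 0 & M^~ 1 =1 N^~ 1].
Proof.
move=> MS.
have M00 : M 0 0 * M 1 1 - M 0 1 * M 1 0 = 1 := MS 0 0.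
pose fd j := (- M 1 j, M 0 j).
pose fg i := (M i 0 * M 1 1 - M i 1 * M 1 0, M i 1 * M 0 0 - M i 0 * M 0 1).
have [d dE] : exists d : bipath (@E_edge R), forall j, val (val d j) = fd j.
  apply: bipath_of_wedges => j; rewrite /wedge /fd /= -(MS 0 j) add0r; ring.
have [g gE] : exists g : bipath (@E_edge R), forall i, val (val g i) = fg i.
  apply: bipath_of_wedges => i.
  by rewrite -[RHS]mulr1 -{1}(MS i 0) -M00 add0r /wedge /=; ring.
exists g, d; split=> k; rewrite /entries gE dE /wedge /fg /fd /=.
all: by rewrite -[LHS]mul1r -M00; ring.
Qed.

Lemma tiling_of_surj (M : @tame_tiling R) :
  exists g d : bipath (@E_edge R), tiling_of g d = M.
Proof.
have Mt := set_valP M.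
have [g [d [M0 M1 N0 N1]]] := tiling_cross_realized Mt.1.
exists g, d; apply/val_inj/funext => i; apply/funext => j /=.
by rewrite -(tame_cross_inj Mt (entries_tame g d)).
Qed.

(** * Orbits *)

Section Orbits.
Variable G : unitSubgroup R.
Local Notation U := (usub G).

Lemma altexpU (l : R) i : U l -> U (altexp l i).
Proof. by move=> Ul; rewrite /altexp; case: odd => //; exact: (rinvU Ul).1. Qed.

Lemma mulpA (A B : 'M[R]_2) p : mulp (A *m B) p = mulp A (mulp B p).
Proof.
rewrite /mulp !mxE !big_ord_recl !big_ord0 /=.
have -> : lift 0 0 = 1 :> 'I_2 by apply/val_inj.
by congr pair; ring.
Qed.

Lemma SL2_pair_comp (A B : @SL2 R) : exists C : @SL2 R,
  forall x, SL2_pair (G := G) A (SL2_pair B x) = SL2_pair C x.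
Proof.
have SC : SL2 (val A *m val B).
  by rewrite /SL2 /= det_mulmx (set_valP A) (set_valP B) mulr1.
exists (set_elt SC) => -[g d].
have E (h : @farey_path R G) :
    SL2_path A (SL2_path B h) = SL2_path (set_elt SC) h.
  apply/val_inj/funext => i; apply/val_inj => /=.
  by rewrite image_comp; apply: eq_imagel => p _; rewrite mulpA.
by rewrite /SL2_pair /= !E.
Qed.

Lemma UU_orbit_mem (M N : @tame_tiling R) :
  to_orbit (UU_tiling (G := G)) M = to_orbit (UU_tiling (G := G)) N ->
  exists lm, UU_tiling (G := G) lm M = N.
Proof.
move=> /(congr1 val) /= E.
have : orbit_of (UU_tiling (G := G)) N N.
  exists (set_elt (usub1 G), set_elt (usub1 G)) => //.
  apply/val_inj/funext => i; apply/funext => j /=.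
  have a1 k : altexp (1 : R) k = 1.
    by rewrite /altexp; case: odd => //; apply: rinvE; rewrite mulr1.
  by rewrite !a1 !mul1r.
by rewrite -E => -[lm _ <-]; exists lm.
Qed.

(** The unit factors by which the two tilings differ are moved into the lifts
    of the first pair, where they do not change the paths in the Farey complex,
    so that rigidity applies. *)
Lemma Phi_orbit_inj (x y : @farey_path R G * @farey_path R G) :
  Phi (to_orbit (SL2_pair (G := G)) x) = Phi (to_orbit (SL2_pair (G := G)) y) ->
  exists A, SL2_pair A x = y.
Proof.
case: x y => [g d] [g' d'].
have [[a aP] [b bP]] := (lift_ex g, lift_ex d).
have [[a' aP'] [b' bP']] := (lift_ex g', lift_ex d').
rewrite (PhiE aP bP) (PhiE aP' bP') => /UU_orbit_mem [[l m] lmE].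
have [_ Vl] := rinvU (set_valP l).
have edge (h : bipath (@E_edge R)) : wedge (val (val h 0)) (val (val h 1)) = 1.
  exact: set_valP h 1.
have [|||i j|A SA [Aa Ab]] := @entries_rigid
  (fun i => scalep (altexp (val l) i) (val (val a i)))
  (fun j => scalep (altexp (val m) j) (val (val b j)))
  (fun i => val (val a' i)) (fun j => val (val b' j)).
- by rewrite wedge_scale edge mulr1; exact: altexpS Vl 1.
- exact: edge.
- exact: edge.
- rewrite wedge_scale.
  by have /= := congr1 (fun M : @tame_tiling R => val M i j) lmE.
exists (set_elt SA).
have act (h h' : @farey_path R G) (c c' : bipath (@E_edge R)) (n : U) :
    lifts_to c h -> lifts_to c' h' ->
    (forall i, mulp A (scalep (altexp (val n) i) (val (val c i))) =
               val (val c' i)) ->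
    SL2_path (set_elt SA) h = h'.
  move=> ch ch' E; apply/val_inj/funext => i /=.
  rewrite -ch -ch' SL2_vertex_pi; apply/esym/farey_piP.
  exists (altexp (val n) i); first by apply: altexpU; exact: set_valP n.
  by rewrite -E mulp_scale.
by rewrite /SL2_pair /= (act _ _ _ _ _ aP aP' Aa) (act _ _ _ _ _ bP bP' Ab).
Qed.

Lemma Phi_injective : injective (@Phi R G).
Proof.
have sub x y : Phi (to_orbit (SL2_pair (G := G)) x) =
    Phi (to_orbit (SL2_pair (G := G)) y) ->
    orbit_of (SL2_pair (G := G)) y `<=` orbit_of (SL2_pair (G := G)) x.
  move=> /Phi_orbit_inj [A <-] _ [B _ <-].
  by have [C ->] := SL2_pair_comp B A; exists C.
move=> O O'; have [x <-] := orbit_repr_ex O; have [y <-] := orbit_repr_ex O'.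
by move=> E; apply/val_inj/seteqP; split; apply: sub.
Qed.

Lemma Phi_surjective (O : orbit_space (UU_tiling (G := G))) :
  exists P, @Phi R G P = O.
Proof.
have [M <-] := orbit_repr_ex O; have [a [b <-]] := tiling_of_surj M.
have proj (c : bipath (@E_edge R)) : exists h : @farey_path R G, lifts_to c h.
  have hP : @farey_path R G (fun i => farey_pi G (val c i)).
    move=> i; exists (val c (i - 1)), (val c i); split=> //.
    by have -> := set_valP c i; exact: usub1.
  by exists (set_elt hP).
have [[g ga] [d db]] := (proj a, proj b).
by exists (to_orbit _ (g, d)); exact: PhiE.
Qed.

End Orbits.
End Correspondence.

Theorem theorem1p1 (R : comPzRingType) (U : unitSubgroup R) :
  bijective (@Phi R U).
Proof.
have /choice [Psi PsiK] := @Phi_surjective R U.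
by exists Psi => // O; apply: Phi_injective; rewrite PsiK.
Qed.
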